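(* Let $(\mathfrak{L},[\cdot,\cdot],\alpha)$ be a multiplicative Hom-Lie superalgebra and let $r\in\mathfrak{L}^{\otimes2}$ be an even element ($|r|=\bar0$) such that $\alpha^{\otimes2}(r)=r$, $r_{21}=-r$, and $$\alpha^{\otimes3}\big(ad_x([[r,r]]^\alpha)\big)=0\qquad\text{for all }x\in\mathfrak{L}.$$ Define $\Delta:\mathfrak{L}\to\mathfrak{L}^{\otimes2}$ by $\Delta(x)=ad_x(r)$. Then $(\mathfrak{L},[\cdot,\cdot],\Delta,\alpha,r)$ is a multiplicative coboundary Hom-Lie superbialgebra.
   Context: $\mathbb{K}$ is a field of characteristic $0$; superspaces are $\mathbb{Z}_2$-graded; $|x|$ is the parity of a homogeneous $x$. $\tau(x\otimes y)=(-1)^{|x||y|}y\otimes x$, and $\xi(x\otimes y\otimes z)=(-1)^{|x|(|y|+|z|)}y\otimes z\otimes x$. For $r=\sum r_1\otimes r_2$ with homogeneous $r_1,r_2$, $|r|=|r_1|+|r_2|$ and $r_{21}=\tau(r)$. A Hom-Lie superalgebra $(\mathfrak{L},[\cdot,\cdot],\alpha)$ is a superspace with an even bilinear bracket and an even linear map $\alpha$ with $[x,y]=-(-1)^{|x||y|}[y,x]$ and $(-1)^{|x||z|}[\alpha(x),[y,z]]+(-1)^{|z||y|}[\alpha(z),[x,y]]+(-1)^{|y||x|}[\alpha(y),[z,x]]=0$; it is multiplicative if $\alpha([x,y])=[\alpha(x),\alpha(y)]$. A Hom-Lie supercoalgebra $(\mathfrak{L},\Delta,\alpha)$ is a superspace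 with an even linear map $\alpha$ and an even linear map $\Delta:\mathfrak{L}\to\mathfrak{L}\otimes\mathfrak{L}$ with $\mathrm{Im}\,\Delta\subset\mathrm{Im}(1\otimes1-\tau)$ and $(1\otimes1\otimes1+\xi+\xi^2)\circ(\alpha\otimes\Delta)\circ\Delta=0$; it is co-multiplicative if $\Delta\circ\alpha=\alpha^{\otimes2}\circ\Delta$. For $n\ge2$, $ad_x(y_1\otimes\cdots\otimes y_n)=\sum_{i=1}^n(-1)^{|x|(|y_1|+\cdots+|y_{i-1}|)}\alpha(y_1)\otimes\cdots\otimes\alpha(y_{i-1})\otimes[x,y_i]\otimes\alpha(y_{i+1})\otimes\cdots\otimes\alpha(y_n)$. A (multiplicative) Hom-Lie superbialgebra $(\mathfrak{L},[\cdot,\cdot],\Delta,\alpha)$ consists of a (multiplicative) Hom-Lie superalgebra $(\mathfrak{L},[\cdot,\cdot],\alpha)$ and a (co-multiplicative) Hom-Lie supercoalgebra $(\mathfrak{L},\Delta,\alpha)$ with $\Delta([x,y])=ad_{\alpha(x)}(\Delta(y))-(-1)^{|x||y|}ad_{\alpha(y)}(\Delta(x))$. A (multiplicative) coboundary Hom-Lie superbialgebra $(\mathfrak{L},[\cdot,\cdot],\Delta,\alpha,r)$ is a (multiplicative) Hom-Lie superbialgebra with an even element $r\in\mathfrak{L}^{\otimes2}$ such that $\alpha^{\otimes2}(r)=r$ and $\Delta(x)=ad_x(r)$ for all $x$. With $r'=\sum r_1'\otimes r_2'$ a second copy of $r$, $[[r,r]]^\alpha=[r_{12},r_{13}]+[r_{12},r_{23}]+[r_{13},r_{23}]\in\mathfrak{L}^{\otimes3}$,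 where $[r_{12},r_{13}]=\sum(-1)^{|r_1'||r_2|}[r_1,r_1']\otimes\alpha(r_2)\otimes\alpha(r_2')$, $[r_{12},r_{23}]=\sum\alpha(r_1)\otimes[r_2,r_1']\otimes\alpha(r_2')$, $[r_{13},r_{23}]=\sum(-1)^{|r_1'||r_2|}\alpha(r_1)\otimes\alpha(r_1')\otimes[r_2,r_2']$. *)

(* Defs.v *)
From HB Require Import structures.
From mathcomp Require Import all_boot all_algebra.
From mathcomp Require Import generic_quotient ring_quotient boolp finmap.
From mathcomp.multinomials Require Import monalg.

Set Implicit Arguments.
Unset Strict Implicit.
Unset Printing Implicit Defensive.

Import GRing.Theory.
Local Open Scope ring_scope.
Local Open Scope quotient_scope.

Reserved Notation "V ⊗ W" (at level 38, right associativity).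

Definition is_bilinear (K : fieldType) (V W U : lmodType K) (f : V -> W -> U) : Prop :=
  (forall w, linear (f^~ w)) /\ (forall v, linear (f v)).

HB.mixin Record Lmodule_isSuperspace (K : fieldType) V of GRing.Lmodule K V := {
  hcomp : bool -> V -> V;
  hcomp_linear : forall i, linear (hcomp i);
  hcompK : forall i j x, hcomp i (hcomp j x) = if i == j then hcomp j x else 0;
  hcomp_sum : forall x, \sum_i hcomp i x = x
}.

(* A Z/2-graded vector space V = V_0 (+) V_1, given by its lmodType together
   with the projections hcomp i : V -> V_i; parities are booleans, false being
   even, and (+) (addb) is the addition of Z/2. *)
#[short(type="superspaceType")]
HB.structure Definition Superspace (K : fieldType) :=
  {V of GRing.Lmodule K V & Lmodule_isSuperspace K V}.

Section Homogeneous.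
Variables (K : fieldType) (V W : superspaceType K).

HB.instance Definition _ i := GRing.isLinear.Build K V V _ (hcomp i) (@hcomp_linear K V i).

Definition homog (i : bool) (x : V) : Prop := hcomp i x = x.

Lemma homog_hcomp i x : homog i (hcomp i x).
Proof. by rewrite /homog hcompK eqxx. Qed.

Lemma hcomp_homog i j x : homog i x -> hcomp j x = if j == i then x else 0.
Proof. by move=> hx; rewrite -{1}hx hcompK hx. Qed.

End Homogeneous.

Definition is_even_linear (K : fieldType) (V W : superspaceType K) (f : V -> W) : Prop :=
  linear f /\ forall i x, homog i x -> homog i (f x).

(* The constructions on tensor products are locked: failed conversion tests on
   nested tensors are intractable otherwise. *)
Fact tensor_key : unit. Proof. exact: tt. Qed.

Section Tensor.
Variables (K : fieldType) (V W : superspaceType K).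

(* The free vector space on the set V * W. *)
Local Notation free := {malg K[(V * W)%type]}.

Definition tens_relator (z : free) : Prop :=
  (exists a v v' w, z = << (a *: v + v', w) >> - (a *: << (v, w) >> + << (v', w) >>))
  \/ (exists a v w w', z = << (v, a *: w + w') >> - (a *: << (v, w) >> + << (v, w') >>)).

(* The subspace spanned by the relators. *)
Definition tens_rel : {pred free} := fun z =>
  `[< forall S : {pred free}, submod_closed S ->
        (forall x, tens_relator x -> x \in S) -> z \in S >].

Lemma tens_rel_submod : submod_closed tens_rel.
Proof.
split; first by apply/asboolP => S [].
move=> a x y /asboolP hx /asboolP hy; apply/asboolP => S hS hR.
by have [_] := hS; apply; [exact: hx | exact: hy].
Qed.

Lemma tens_relP x : tens_relator x -> x \in tens_rel.
Proof. by move=> hx; apply/asboolP => S _; apply. Qed.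

HB.instance Definition _ := GRing.isSubmodClosed.Build K free tens_rel tens_rel_submod.

Record tensor : predArgType := Tensor { tensor_quot : Quotient.quot (tens_rel : zmodClosed free) }.

HB.instance Definition _ := [isNew for tensor_quot].
HB.instance Definition _ := [Choice of tensor by <:].

Let tpi (z : free) : tensor := Tensor (\pi z).
Let trepr (t : tensor) : free := repr (tensor_quot t).

Let treprK t : tpi (trepr t) = t.
Proof. by case: t => q; rewrite /tpi /trepr reprK. Qed.

Let tpi_eq x y : tpi x = tpi y <-> x - y \in tens_rel.
Proof.
rewrite Quotient.idealrBE; split=> [[/eqP]|/eqP] //.
by rewrite /tpi => ->.
Qed.

Definition tadd : tensor -> tensor -> tensor :=
  locked_with tensor_key (fun s t => tpi (trepr s + trepr t)).
Definition topp : tensor -> tensor :=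
  locked_with tensor_key (fun t => tpi (- trepr t)).
Definition tscale : K -> tensor -> tensor :=
  locked_with tensor_key (fun a t => tpi (a *: trepr t)).

Let taddE s t : tadd s t = tpi (trepr s + trepr t).
Proof. by rewrite /tadd unlock. Qed.
Let toppE t : topp t = tpi (- trepr t).
Proof. by rewrite /topp unlock. Qed.
Let tscaleE a t : tscale a t = tpi (a *: trepr t).
Proof. by rewrite /tscale unlock. Qed.

Let trepr_tpi x : trepr (tpi x) - x \in tens_rel.
Proof. by apply/tpi_eq; rewrite treprK. Qed.

Let tpiD x y : tpi (x + y) = tadd (tpi x) (tpi y).
Proof.
rewrite taddE; apply/esym/tpi_eq; rewrite opprD addrACA.
by apply: rpredD; exact: trepr_tpi.
Qed.

Let tpiN x : tpi (- x) = topp (tpi x).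
Proof. by rewrite toppE; apply/esym/tpi_eq; rewrite -opprD rpredN; exact: trepr_tpi. Qed.

Let tpiZ a x : tpi (a *: x) = tscale a (tpi x).
Proof. by rewrite tscaleE; apply/esym/tpi_eq; rewrite -scalerBr; apply: rpredZ; exact: trepr_tpi. Qed.

Fact taddA : associative tadd.
Proof. by move=> s t u; rewrite -[s]treprK -[t]treprK -[u]treprK -!tpiD addrA. Qed.
Fact taddC : commutative tadd.
Proof. by move=> s t; rewrite !taddE addrC. Qed.
Fact tadd0 : left_id (tpi 0) tadd.
Proof. by move=> t; rewrite -[t]treprK -tpiD add0r. Qed.
Fact taddN : left_inverse (tpi 0) topp tadd.
Proof. by move=> t; rewrite -[t]treprK -tpiN -tpiD addNr. Qed.

HB.instance Definition _ := GRing.isZmodule.Build tensor taddA taddC tadd0 taddN.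

Fact tscaleA a b t : tscale a (tscale b t) = tscale (a * b) t.
Proof. by rewrite -[t]treprK -!tpiZ scalerA. Qed.
Fact tscale1 : left_id 1 tscale.
Proof. by move=> t; rewrite -[t]treprK -!tpiZ scale1r. Qed.
Fact tscaleDr : right_distributive tscale +%R.
Proof.
by move=> a s t; rewrite -[s]treprK -[t]treprK -[_ + _]tpiD -!tpiZ -[RHS]tpiD scalerDr.
Qed.
Fact tscaleDl t : {morph tscale^~ t : a b / a + b}.
Proof. by move=> a b; rewrite -[t]treprK -!tpiZ -[RHS]tpiD scalerDl. Qed.

HB.instance Definition _ :=
  GRing.Zmodule_isLmodule.Build K tensor tscaleA tscale1 tscaleDr tscaleDl.

Let tpi_is_linear : linear tpi.
Proof. by move=> a x y; rewrite [LHS]tpiD tpiZ. Qed.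

Definition tens : V -> W -> tensor :=
  locked_with tensor_key (fun v w => tpi << (v, w) >>).

Let tensE v w : tens v w = tpi << (v, w) >>.
Proof. by rewrite /tens unlock. Qed.

Lemma tens_bilinear : is_bilinear tens.
Proof.
split=> [w|v] a x y; rewrite !tensE -[RHS]tpi_is_linear; apply/tpi_eq/tens_relP.
  by left; exists a, x, y, w.
by right; exists a, v, x, y.
Qed.

Lemma tensDl x y w : tens (x + y) w = tens x w + tens y w.
Proof. by have := proj1 tens_bilinear w 1 x y; rewrite !scale1r. Qed.

Lemma tensDr v x y : tens v (x + y) = tens v x + tens v y.
Proof. by have := proj2 tens_bilinear v 1 x y; rewrite !scale1r. Qed.

Lemma tens0l w : tens 0 w = 0.
Proof. by apply: (addrI (tens 0 w)); rewrite -tensDl !addr0. Qed.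

Lemma tens0r v : tens v 0 = 0.
Proof. by apply: (addrI (tens v 0)); rewrite -tensDr !addr0. Qed.

Lemma tensZl a v w : tens (a *: v) w = a *: tens v w.
Proof. by have := proj1 tens_bilinear w a v 0; rewrite tens0l !addr0. Qed.

Lemma tensZr a v w : tens v (a *: w) = a *: tens v w.
Proof. by have := proj2 tens_bilinear v a w 0; rewrite tens0r !addr0. Qed.

(* The linear map on V ⊗ W induced by f, computed on a representative; it is
   only meaningful when f is bilinear (see tliftE and tlift_linear). *)
Definition tlift (U : lmodType K) : (V -> W -> U) -> tensor -> U :=
  locked_with tensor_key (fun f t =>
    \sum_(p <- msupp (trepr t)) (trepr t)@_p *: f p.1 p.2).

Let tlift_def (U : lmodType K) (f : V -> W -> U) t :
  tlift f t = \sum_(p <- msupp (trepr t)) (trepr t)@_p *: f p.1 p.2.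
Proof. by rewrite /tlift unlock. Qed.

Section Lift.
Variables (U : lmodType K) (f : V -> W -> U).

Let flift (z : free) : U := \sum_(p <- msupp z) z@_p *: f p.1 p.2.

Let fliftw (d : {fset (V * W)%type}) z : (msupp z `<=` d)%fset ->
  flift z = \sum_(p <- d) z@_p *: f p.1 p.2.
Proof.
move=> le_d; rewrite /flift (big_fset_incl _ le_d) // => p _ /mcoeff_outdom ->.
by rewrite scale0r.
Qed.

Let flift_linear : linear flift.
Proof.
move=> a x y; set d := (msupp x `|` msupp y)%fset.
have hx : (msupp x `<=` d)%fset by exact: fsubsetUl.
have hy : (msupp y `<=` d)%fset by exact: fsubsetUr.
have hxy : (msupp (a *: x + y) `<=` d)%fset.
  apply: fsubset_trans (msuppD_le _ _) _; apply: fsetSU; exact: msuppZ_le.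
rewrite (fliftw hx) (fliftw hy) (fliftw hxy) scaler_sumr -big_split.
by apply: eq_bigr => p _; rewrite mcoeffD mcoeffZ scalerDl scalerA.
Qed.

Let fliftU v w : flift << (v, w) >> = f v w.
Proof. by rewrite (fliftw msuppU_le) big_seq_fset1 mcoeffUU scale1r. Qed.

Hypothesis f_bil : is_bilinear f.

Let flift_rel z : z \in tens_rel -> flift z = 0.
Proof.
move=> /asboolP /(_ [pred z | flift z == 0]) h; apply/eqP; apply: h => [|x].
  have h0 : flift 0 = 0 by rewrite /flift msupp0 big_seq_fset0.
  split=> [|a x y]; rewrite !inE ?h0 // => /eqP hx /eqP hy.
  by rewrite flift_linear hx hy scaler0 addr0.
have flB a b : flift (a - b) = flift a - flift b.
  by rewrite [a - b]addrC -[- b]scaleN1r flift_linear scaleN1r addrC.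
rewrite inE; case=> [[a [v [v' [w ->]]]]|[a [v [w [w' ->]]]]].
  by rewrite flB flift_linear !fliftU (proj1 f_bil) subrr.
by rewrite flB flift_linear !fliftU (proj2 f_bil) subrr.
Qed.

Let tliftpi z : tlift f (tpi z) = flift z.
Proof.
rewrite tlift_def -/(flift _); apply/eqP; rewrite -subr_eq0 addrC -scaleN1r.
rewrite -flift_linear flift_rel // scaleN1r addrC.
by apply/tpi_eq; rewrite treprK.
Qed.

Lemma tliftE v w : tlift f (tens v w) = f v w.
Proof. by rewrite tensE tliftpi fliftU. Qed.

Lemma tlift_linear : linear (tlift f).
Proof.
by move=> a s t; rewrite -[s]treprK -[t]treprK -tpi_is_linear !tliftpi flift_linear.
Qed.

End Lift.

Lemma tlift_linear_fun (U : lmodType K) a (f g : V -> W -> U) t :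
  tlift (fun v w => a *: f v w + g v w) t = a *: tlift f t + tlift g t.
Proof.
rewrite !tlift_def scaler_sumr -big_split; apply: eq_bigr => p _ /=.
by rewrite scalerDr !scalerA mulrC.
Qed.

Lemma eq_tlift (U : lmodType K) (f g : V -> W -> U) t :
  (forall v w, f v w = g v w) -> tlift f t = tlift g t.
Proof. by move=> fg; rewrite !tlift_def; apply: eq_bigr => p _; rewrite fg. Qed.

(* V ⊗ W is spanned by the pure tensors. *)
Lemma tens_ext (U : lmodType K) (f g : tensor -> U) : linear f -> linear g ->
  (forall v w, f (tens v w) = g (tens v w)) -> forall t, f t = g t.
Proof.
move=> f_lin g_lin fg t.
pose F : {linear tensor -> U} := HB.pack f (GRing.isLinear.Build K tensor U _ f f_lin).
pose G : {linear tensor -> U} := HB.pack g (GRing.isLinear.Build K tensor U _ g g_lin).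
pose P : {linear free -> tensor} :=
  HB.pack tpi (GRing.isLinear.Build K free tensor _ tpi tpi_is_linear).
rewrite -[f]/(F : _ -> _) -[g]/(G : _ -> _) -[t]treprK -[tpi]/(P : _ -> _).
rewrite [trepr t]monalgE !linear_sum; apply: eq_bigr => -[v w] _.
suff -> : << (trepr t)@_(v, w) *g (v, w) >> = (trepr t)@_(v, w) *: << (v, w) >> :> free.
  by rewrite !linearZ; congr (_ *: _); have := fg v w; rewrite tensE.
by apply/malgP => k; rewrite mcoeffZ !mcoeffU mulrnAr mulr1.
Qed.

End Tensor.

Arguments tensor {K} (V W)%_type.
Notation "V ⊗ W" := (tensor V W) : type_scope.
Notation "v ⊗ w" := (tens v w) : ring_scope.

Section Bilinear.
Variables (K : fieldType) (V W U : lmodType K).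
Implicit Types f g : V -> W -> U.

Lemma bilinear_add f g : is_bilinear f -> is_bilinear g ->
  is_bilinear (fun v w => f v w + g v w).
Proof.
by move=> [f1 f2] [g1 g2]; split=> u a x y; rewrite ?f1 ?g1 ?f2 ?g2 scalerDr addrACA.
Qed.

Lemma bilinear_scale c f : is_bilinear f -> is_bilinear (fun v w => c *: f v w).
Proof.
by move=> [f1 f2]; split=> u a x y; rewrite ?f1 ?f2 scalerDr !scalerA mulrC.
Qed.

Lemma bilinear_sum (F : bool -> V -> W -> U) : (forall i, is_bilinear (F i)) ->
  is_bilinear (fun v w => \sum_i F i v w).
Proof.
move=> hF; split=> u a x y; rewrite !big_bool ?(proj1 (hF _)) ?(proj2 (hF _)) scalerDr;
  exact: addrACA.
Qed.

Lemma bilinear_swap f : is_bilinear f -> is_bilinear (fun w v => f v w).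
Proof. by move=> [f1 f2]; split. Qed.

Lemma bilinear_comp (V' W' : lmodType K) f (g : V' -> V) (h : W' -> W) :
  is_bilinear f -> linear g -> linear h -> is_bilinear (fun v w => f (g v) (h w)).
Proof. by move=> [f1 f2] g1 h1; split=> u a x y; rewrite ?g1 ?h1 ?f1 ?f2. Qed.

Lemma bilinear_lcomp (U' : lmodType K) f (g : U -> U') :
  is_bilinear f -> linear g -> is_bilinear (fun v w => g (f v w)).
Proof. by move=> [f1 f2] g1; split=> u a x y; rewrite ?f1 ?f2 g1. Qed.

End Bilinear.

Section TensorSuperspace.
Variables (K : fieldType) (V W : superspaceType K).

(* (V ⊗ W)_k is the sum of the V_i ⊗ W_j with i + j = k. *)
Definition tens_hcomp (k : bool) : V ⊗ W -> V ⊗ W :=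
  tlift (fun v w => \sum_i hcomp i v ⊗ hcomp (i (+) k) w).

Let body_bilinear k :
  is_bilinear (fun (v : V) (w : W) => \sum_i hcomp i v ⊗ hcomp (i (+) k) w).
Proof.
apply: bilinear_sum => i.
by apply: (bilinear_comp (@tens_bilinear K V W)); exact: hcomp_linear.
Qed.

Fact tens_hcomp_linear k : linear (tens_hcomp k).
Proof. exact: tlift_linear. Qed.

Fact tens_hcompK i j t :
  tens_hcomp i (tens_hcomp j t) = if i == j then tens_hcomp j t else 0.
Proof.
apply: (tens_ext (f := fun t => tens_hcomp i (tens_hcomp j t))
                 (g := fun t => if i == j then tens_hcomp j t else 0)) => [a x y|a x y|v w].
- by rewrite !tens_hcomp_linear.
- by case: eqP; rewrite ?tens_hcomp_linear // scaler0 addr0.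
have E k x y : tens_hcomp k (x ⊗ y) = \sum_i hcomp i x ⊗ hcomp (i (+) k) y
  := tliftE (body_bilinear k) x y.
have D k x y : tens_hcomp k (x + y) = tens_hcomp k x + tens_hcomp k y.
  by have := tens_hcomp_linear k 1 x y; rewrite !scale1r.
rewrite [tens_hcomp j _]E big_bool D !E !big_bool !hcompK.
by case: i; case: j => /=; rewrite ?(tens0l, tens0r) ?(addr0, add0r).
Qed.

Fact tens_hcomp_sum t : \sum_i tens_hcomp i t = t.
Proof.
apply: (tens_ext (f := fun t => \sum_i tens_hcomp i t) (g := id)) => // [a x y|v w].
  by rewrite !big_bool !tens_hcomp_linear scalerDr addrACA.
have E k x y : tens_hcomp k (x ⊗ y) = \sum_i hcomp i x ⊗ hcomp (i (+) k) y
  := tliftE (body_bilinear k) x y.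
rewrite big_bool !E !big_bool /= addrACA.
have sumE (X : superspaceType K) (x : X) : hcomp true x + hcomp false x = x.
  by rewrite -[RHS]hcomp_sum big_bool.
by rewrite -!tensDr [hcomp false w + _]addrC !sumE -tensDl sumE.
Qed.

HB.instance Definition _ := Lmodule_isSuperspace.Build K (V ⊗ W)%type
  tens_hcomp_linear tens_hcompK tens_hcomp_sum.

End TensorSuperspace.

Lemma homog_tens (K : fieldType) (V W : superspaceType K) i j (x : V) (y : W) :
  homog i x -> homog j y -> homog (i (+) j) (x ⊗ y).
Proof.
move=> hx hy; rewrite /homog /hcomp /= /tens_hcomp tliftE; last first.
  by apply: bilinear_sum => k; apply: bilinear_comp (@tens_bilinear K V W) _ _;
    exact: hcomp_linear.
rewrite big_bool !(hcomp_homog _ hx) !(hcomp_homog _ hy).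
by case: i j {hx hy} => [] [] /=; rewrite ?(tens0l, tens0r) ?(addr0, add0r).
Qed.

Section HomogeneousLift.
Variables (K : fieldType).

(* The linear map on V ⊗ W whose value at x ⊗ y is f i j x y for x and y
   homogeneous of parities i and j. *)
Definition hlift2 (V W : superspaceType K) (U : lmodType K)
    (f : bool -> bool -> V -> W -> U) : V ⊗ W -> U :=
  tlift (fun x y => \sum_i \sum_j f i j (hcomp i x) (hcomp j y)).

(* The same on V ⊗ (W ⊗ X). *)
Definition hlift3 (V W X : superspaceType K) (U : lmodType K)
    (f : bool -> bool -> bool -> V -> W -> X -> U) : V ⊗ W ⊗ X -> U :=
  tlift (fun x t => \sum_i hlift2 (fun j k y z => f i j k (hcomp i x) y z) t).

Section Lift2.
Variables (V W : superspaceType K) (U : lmodType K).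
Implicit Type f : bool -> bool -> V -> W -> U.

Let body_bilinear f : (forall i j, is_bilinear (f i j)) ->
  is_bilinear (fun x y => \sum_i \sum_j f i j (hcomp i x) (hcomp j y)).
Proof.
move=> fB; apply: bilinear_sum => i; apply: bilinear_sum => j.
by apply: bilinear_comp (fB i j) _ _; exact: hcomp_linear.
Qed.

Lemma hlift2_linear f : (forall i j, is_bilinear (f i j)) -> linear (hlift2 f).
Proof. by move=> /body_bilinear fB; exact: tlift_linear. Qed.

Lemma hlift2E f i j x y : (forall i j, is_bilinear (f i j)) ->
  homog i x -> homog j y -> hlift2 f (x ⊗ y) = f i j x y.
Proof.
move=> fB hx hy; rewrite /hlift2 tliftE; last exact: body_bilinear.
have f0l k l w : f k l 0 w = 0.
  apply: (addrI (f k l 0 w)); rewrite addr0.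
  by have := proj1 (fB k l) w 1 0 0; rewrite !scale1r addr0.
have f0r k l v : f k l v 0 = 0.
  apply: (addrI (f k l v 0)); rewrite addr0.
  by have := proj2 (fB k l) v 1 0 0; rewrite !scale1r addr0.
rewrite !big_bool /= !(hcomp_homog _ hx) !(hcomp_homog _ hy).
by case: i j {hx hy} => [] [] /=; rewrite !(f0l, f0r, addr0, add0r).
Qed.

Lemma hlift2_linear_fun a f g t :
  hlift2 (fun i j x y => a *: f i j x y + g i j x y) t = a *: hlift2 f t + hlift2 g t.
Proof.
rewrite /hlift2 -tlift_linear_fun; apply: eq_tlift => v w; rewrite scaler_sumr -big_split.
by apply: eq_bigr => i _; rewrite /= scaler_sumr -big_split.
Qed.

Lemma eq_hlift2 f g t : (forall i j x y, f i j x y = g i j x y) -> hlift2 f t = hlift2 g t.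
Proof.
by move=> fg; apply: eq_tlift => v w; apply: eq_bigr => i _; apply: eq_bigr => j _.
Qed.

End Lift2.

Section Lift3.
Variables (V W X : superspaceType K) (U : lmodType K).
Variable f : bool -> bool -> bool -> V -> W -> X -> U.
Hypothesis f_lin : forall i j k y z, linear (fun x => f i j k x y z).
Hypothesis f_bil : forall i j k x, is_bilinear (f i j k x).

Let body_bilinear i :
  is_bilinear (fun x t => hlift2 (fun j k y z => f i j k (hcomp i x) y z) t).
Proof.
split=> [t a x x'|x]; last by apply: hlift2_linear => j k; exact: f_bil.
by rewrite -hlift2_linear_fun; apply: eq_hlift2 => j k y z; rewrite hcomp_linear f_lin.
Qed.

Lemma hlift3_linear : linear (hlift3 f).
Proof. exact: tlift_linear (bilinear_sum body_bilinear). Qed.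

Lemma hlift3E i j k x y z : homog i x -> homog j y -> homog k z ->
  hlift3 f (x ⊗ y ⊗ z) = f i j k x y z.
Proof.
move=> hx hy hz; rewrite /hlift3 (tliftE (bilinear_sum body_bilinear)).
rewrite (eq_bigr (fun i' => f i' j k (hcomp i' x) y z)) => [|i' _]; last first.
  by rewrite (hlift2E _ hy hz).
have f0 i' : f i' j k 0 y z = 0.
  apply: (addrI (f i' j k 0 y z)); rewrite addr0.
  by have := @f_lin i' j k y z 1 0 0; rewrite !scale1r addr0.
by rewrite big_bool !(hcomp_homog _ hx); case: i {hx} => /=; rewrite f0 ?(addr0, add0r).
Qed.

End Lift3.
End HomogeneousLift.

Section TensorMaps.
Variable K : fieldType.

(* f ⊗ g. No sign is needed: it is only used for even g. *)
Definition tens_map (V V' W W' : superspaceType K) (f : V -> V') (g : W -> W') :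
    V ⊗ W -> V' ⊗ W' :=
  tlift (fun x y => f x ⊗ g y).

Variable L : superspaceType K.

Definition tau : L ⊗ L -> L ⊗ L :=
  hlift2 (fun i j x y => (-1) ^+ (i && j) *: y ⊗ x).

Definition xi : L ⊗ L ⊗ L -> L ⊗ L ⊗ L :=
  hlift3 (fun i j k x y z => (-1) ^+ (i && (j (+) k)) *: y ⊗ z ⊗ x).

End TensorMaps.

Section HomLie.
Variables (K : fieldType) (L : superspaceType K).
Implicit Types (br : L -> L -> L) (alpha : L -> L) (Delta : L -> L ⊗ L).

Record hom_Lie_superalgebra br alpha : Prop := {
  bracket_bilinear : is_bilinear br;
  bracket_even : forall i j x y, homog i x -> homog j y -> homog (i (+) j) (br x y);
  superalgebra_twist : is_even_linear alpha;
  bracket_skew : forall i j x y, homog i x -> homog j y ->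
    br x y = - ((-1) ^+ (i && j) *: br y x);
  hom_Jacobi : forall i j k x y z, homog i x -> homog j y -> homog k z ->
    (-1) ^+ (i && k) *: br (alpha x) (br y z)
    + (-1) ^+ (k && j) *: br (alpha z) (br x y)
    + (-1) ^+ (j && i) *: br (alpha y) (br z x) = 0
}.

Record multiplicative_hom_Lie_superalgebra br alpha : Prop := {
  multiplicative_superalgebra : hom_Lie_superalgebra br alpha;
  alpha_bracket : forall x y, alpha (br x y) = br (alpha x) (alpha y)
}.

Record hom_Lie_supercoalgebra Delta alpha : Prop := {
  cobracket_even : is_even_linear Delta;
  supercoalgebra_twist : is_even_linear alpha;
  cobracket_skew : forall x, exists t, Delta x = t - tau t;
  hom_coJacobi : forall x, let t := tens_map alpha Delta (Delta x) in
    t + xi t + xi (xi t) = 0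
}.

Record comultiplicative_hom_Lie_supercoalgebra Delta alpha : Prop := {
  comultiplicative_supercoalgebra : hom_Lie_supercoalgebra Delta alpha;
  cobracket_alpha : forall x, Delta (alpha x) = tens_map alpha alpha (Delta x)
}.

(* ad_x on the tensor square and on the tensor cube of L, extended linearly to
   non-homogeneous x. *)
Definition ad2 br alpha (x : L) (t : L ⊗ L) : L ⊗ L :=
  \sum_p hlift2 (fun i j y1 y2 =>
    br (hcomp p x) y1 ⊗ alpha y2
    + (-1) ^+ (p && i) *: alpha y1 ⊗ br (hcomp p x) y2) t.

Definition ad3 br alpha (x : L) (t : L ⊗ L ⊗ L) : L ⊗ L ⊗ L :=
  \sum_p hlift3 (fun i j k y1 y2 y3 =>
    br (hcomp p x) y1 ⊗ alpha y2 ⊗ alpha y3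
    + (-1) ^+ (p && i) *: alpha y1 ⊗ br (hcomp p x) y2 ⊗ alpha y3
    + (-1) ^+ (p && (i (+) j)) *: alpha y1 ⊗ alpha y2 ⊗ br (hcomp p x) y3) t.

Record hom_Lie_superbialgebra br Delta alpha : Prop := {
  superbialgebra_superalgebra : hom_Lie_superalgebra br alpha;
  superbialgebra_supercoalgebra : hom_Lie_supercoalgebra Delta alpha;
  cobracket_bracket : forall i j x y, homog i x -> homog j y ->
    Delta (br x y) = ad2 br alpha (alpha x) (Delta y)
                     - (-1) ^+ (i && j) *: ad2 br alpha (alpha y) (Delta x)
}.

Record multiplicative_hom_Lie_superbialgebra br Delta alpha : Prop := {
  multiplicative_superbialgebra : hom_Lie_superbialgebra br Delta alpha;
  superbialgebra_multiplicative : multiplicative_hom_Lie_superalgebra br alpha;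
  superbialgebra_comultiplicative : comultiplicative_hom_Lie_supercoalgebra Delta alpha
}.

Record multiplicative_coboundary_hom_Lie_superbialgebra br Delta alpha (r : L ⊗ L) : Prop := {
  coboundary_superbialgebra : multiplicative_hom_Lie_superbialgebra br Delta alpha;
  coboundary_even : homog false r;
  coboundary_alpha : tens_map alpha alpha r = r;
  coboundary_Delta : forall x, Delta x = ad2 br alpha x r
}.

(* The summands of [[r, r']]^alpha, for r = sum r1 ⊗ r2 and r' = sum r1' ⊗ r2'. *)
Definition r12_r13 br alpha (r r' : L ⊗ L) : L ⊗ L ⊗ L :=
  hlift2 (fun i j r1 r2 => hlift2 (fun i' j' r1' r2' =>
    (-1) ^+ (i' && j) *: br r1 r1' ⊗ alpha r2 ⊗ alpha r2') r') r.

Definition r12_r23 br alpha (r r' : L ⊗ L) : L ⊗ L ⊗ L :=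
  hlift2 (fun i j r1 r2 => hlift2 (fun i' j' r1' r2' =>
    alpha r1 ⊗ br r2 r1' ⊗ alpha r2') r') r.

Definition r13_r23 br alpha (r r' : L ⊗ L) : L ⊗ L ⊗ L :=
  hlift2 (fun i j r1 r2 => hlift2 (fun i' j' r1' r2' =>
    (-1) ^+ (i' && j) *: alpha r1 ⊗ alpha r1' ⊗ br r2 r2') r') r.

Definition hom_schouten br alpha (r : L ⊗ L) : L ⊗ L ⊗ L :=
  r12_r13 br alpha r r + r12_r23 br alpha r r + r13_r23 br alpha r r.

End HomLie.

(* The maps above have the expected values on homogeneous pure tensors. *)
Section Evaluation.
Variables (K : fieldType).

Lemma tens_map_linear (V V' W W' : superspaceType K) (f : V -> V') (g : W -> W') :
  linear f -> linear g -> linear (tens_map f g).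
Proof.
by move=> f_lin g_lin; apply: tlift_linear; exact: bilinear_comp (@tens_bilinear _ _ _) _ _.
Qed.

Lemma tens_mapE (V V' W W' : superspaceType K) (f : V -> V') (g : W -> W') x y :
  linear f -> linear g -> tens_map f g (x ⊗ y) = f x ⊗ g y.
Proof.
by move=> f_lin g_lin; apply: tliftE; exact: bilinear_comp (@tens_bilinear _ _ _) _ _.
Qed.

Variable L : superspaceType K.

Let tau_body i j : is_bilinear (fun x y : L => (-1) ^+ (i && j) *: y ⊗ x).
Proof. exact/bilinear_scale/bilinear_swap/tens_bilinear. Qed.

Lemma tau_linear : linear (@tau K L).
Proof. exact: hlift2_linear tau_body. Qed.

Lemma tauE i j (x y : L) : homog i x -> homog j y ->
  tau (x ⊗ y) = (-1) ^+ (i && j) *: y ⊗ x.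
Proof. by move=> hx hy; rewrite /tau (hlift2E tau_body hx hy). Qed.

Let xi_lin i j k (y z : L) : linear (fun x : L => (-1) ^+ (i && (j (+) k)) *: y ⊗ z ⊗ x).
Proof.
by move=> a x x'; rewrite 2!(proj2 (@tens_bilinear _ _ _)) scalerDr !scalerA mulrC.
Qed.

Let xi_bil i j k (x : L) : is_bilinear (fun y z : L => (-1) ^+ (i && (j (+) k)) *: y ⊗ z ⊗ x).
Proof.
apply: bilinear_scale; split=> u a v w; first exact: (proj1 (@tens_bilinear _ _ _)).
by rewrite (proj1 (@tens_bilinear _ L L)) (proj2 (@tens_bilinear _ _ _)).
Qed.

Lemma xi_linear : linear (@xi K L).
Proof. exact: hlift3_linear xi_lin xi_bil. Qed.

Lemma xiE i j k (x y z : L) : homog i x -> homog j y -> homog k z ->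
  xi (x ⊗ y ⊗ z) = (-1) ^+ (i && (j (+) k)) *: y ⊗ z ⊗ x.
Proof. by move=> hx hy hz; rewrite /xi (hlift3E xi_lin xi_bil hx hy hz). Qed.

Variables (br : L -> L -> L) (alpha : L -> L).
Hypotheses (br_bil : is_bilinear br) (alpha_lin : linear alpha).

Let br0l y : br 0 y = 0.
Proof.
apply: (addrI (br 0 y)); rewrite addr0.
by have := proj1 br_bil y 1 0 0; rewrite !scale1r addr0.
Qed.

Let ad2_body p x (i j : bool) : is_bilinear (fun y1 y2 =>
  br (hcomp p x) y1 ⊗ alpha y2 + (-1) ^+ (p && i) *: alpha y1 ⊗ br (hcomp p x) y2).
Proof.
apply: bilinear_add; [|apply: bilinear_scale];
  apply: bilinear_comp (@tens_bilinear _ L L) _ _ => //; exact: (proj2 br_bil).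
Qed.

Let sum_linear (V W : lmodType K) (F : bool -> V -> W) :
  (forall p, linear (F p)) -> linear (fun t => \sum_p F p t).
Proof. by move=> F_lin a s t; rewrite !big_bool !F_lin scalerDr addrACA. Qed.

Lemma ad2_linear x : linear (ad2 br alpha x).
Proof. by apply: sum_linear => p; apply: hlift2_linear => i j; exact: ad2_body. Qed.

Lemma ad2E p i j x y1 y2 : homog p x -> homog i y1 -> homog j y2 ->
  ad2 br alpha x (y1 ⊗ y2) =
    br x y1 ⊗ alpha y2 + (-1) ^+ (p && i) *: alpha y1 ⊗ br x y2.
Proof.
move=> hx h1 h2; rewrite /ad2.
under eq_bigr => q _ do rewrite (hlift2E (ad2_body q x) h1 h2) (hcomp_homog _ hx).
by rewrite big_bool; case: p {hx} => /=;
  rewrite !br0l !(tens0l, tens0r, scaler0, addr0, add0r).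
Qed.

Let lin_add (V W : lmodType K) (f g : V -> W) :
  linear f -> linear g -> linear (fun x => f x + g x).
Proof. by move=> f_lin g_lin a x y; rewrite f_lin g_lin scalerDr addrACA. Qed.

Let lin_scale (V W : lmodType K) c (f : V -> W) :
  linear f -> linear (fun x => c *: f x).
Proof. by move=> f_lin a x y; rewrite f_lin scalerDr !scalerA mulrC. Qed.

Let tens3_lin2 (f g h : L -> L) :
  linear f -> linear g -> linear h -> 
  (forall y z, linear (fun x => f x ⊗ g y ⊗ h z)) /\
  (forall x, is_bilinear (fun y z => f x ⊗ g y ⊗ h z)).
Proof.
move=> f_lin g_lin h_lin; split=> [y z a x x'|x].
  by rewrite f_lin (proj1 (@tens_bilinear _ _ _)).
apply: bilinear_lcomp (proj2 (@tens_bilinear _ _ _) _).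
exact: bilinear_comp (@tens_bilinear _ _ _) _ _.
Qed.

Let ad3_body p x (i j : bool) :
  let F y1 y2 y3 := br (hcomp p x) y1 ⊗ alpha y2 ⊗ alpha y3
    + (-1) ^+ (p && i) *: alpha y1 ⊗ br (hcomp p x) y2 ⊗ alpha y3
    + (-1) ^+ (p && (i (+) j)) *: alpha y1 ⊗ alpha y2 ⊗ br (hcomp p x) y3 in
  (forall y2 y3, linear (fun y1 => F y1 y2 y3)) /\ (forall y1, is_bilinear (F y1)).
Proof.
have br_lin := proj2 br_bil (hcomp p x).
have [l1 b1] := tens3_lin2 br_lin alpha_lin alpha_lin.
have [l2 b2] := tens3_lin2 alpha_lin br_lin alpha_lin.
have [l3 b3] := tens3_lin2 alpha_lin alpha_lin br_lin.
move=> F; split=> [y2 y3|y1].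
  exact: lin_add (lin_add (l1 _ _) (lin_scale _ (l2 _ _))) (lin_scale _ (l3 _ _)).
apply: bilinear_add; last exact/bilinear_scale/b3.
by apply: bilinear_add (b1 _) _; exact/bilinear_scale/b2.
Qed.

Lemma ad3_linear x : linear (ad3 br alpha x).
Proof.
apply: sum_linear => p; apply: hlift3_linear => i j k.
  exact: (ad3_body p x i j).1.
exact: (ad3_body p x i j).2.
Qed.

Lemma ad3E p i j k x y1 y2 y3 : homog p x -> homog i y1 -> homog j y2 -> homog k y3 ->
  ad3 br alpha x (y1 ⊗ y2 ⊗ y3) =
    br x y1 ⊗ alpha y2 ⊗ alpha y3
    + (-1) ^+ (p && i) *: alpha y1 ⊗ br x y2 ⊗ alpha y3
    + (-1) ^+ (p && (i (+) j)) *: alpha y1 ⊗ alpha y2 ⊗ br x y3.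
Proof.
move=> hx h1 h2 h3.
have E q := hlift3E (fun i j (_ : bool) => (ad3_body q x i j).1)
                    (fun i j (_ : bool) => (ad3_body q x i j).2) h1 h2 h3.
rewrite /ad3 big_bool !E !(hcomp_homog _ hx).
by case: p {hx E} => /=;
  rewrite !br0l !(tens0l, tens0r, scaler0, addr0, add0r).
Qed.

Section TwoCopies.
Variable F : bool -> bool -> L -> L -> bool -> bool -> L -> L -> L ⊗ L ⊗ L.
Hypothesis F_bil : forall i j x y i' j', is_bilinear (F i j x y i' j').
Hypothesis F_bil' : forall i j i' j' x' y',
  is_bilinear (fun x y => F i j x y i' j' x' y').

Let inner_bilinear r' i j : is_bilinear (fun x y => hlift2 (F i j x y) r').
Proof.
by split=> u a x x'; rewrite -hlift2_linear_fun; apply: eq_hlift2 => i' j' x1 y1;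
  [exact: (F_bil' i j i' j' x1 y1).1 | exact: (F_bil' i j i' j' x1 y1).2].
Qed.

Lemma two_copies_bilinear :
  is_bilinear (fun r r' => hlift2 (fun i j x y => hlift2 (F i j x y) r') r).
Proof.
split=> [r'|r]; first by apply: hlift2_linear; exact: inner_bilinear.
move=> a s t; rewrite -hlift2_linear_fun; apply: eq_hlift2 => i j x y.
by apply: hlift2_linear; exact: F_bil.
Qed.

Lemma two_copiesE i j i' j' x y x' y' : homog i x -> homog j y -> homog i' x' -> homog j' y' ->
  hlift2 (fun i j x y => hlift2 (F i j x y) (x' ⊗ y')) (x ⊗ y) = F i j x y i' j' x' y'.
Proof.
move=> hx hy hx' hy'; rewrite (hlift2E (inner_bilinear _) hx hy).
exact: hlift2E (F_bil _ _ _ _) hx' hy'.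
Qed.

End TwoCopies.

Let br_lin x : linear (br x) := proj2 br_bil x.
Let br_lin' y : linear (br^~ y) := proj1 br_bil y.
Let tlin (V W : superspaceType K) (v : V) : linear (fun w : W => v ⊗ w) :=
  proj2 (@tens_bilinear K V W) v.
Let tlin' (V W : superspaceType K) (w : W) : linear (fun v : V => v ⊗ w) :=
  proj1 (@tens_bilinear K V W) w.

Let linear_comp (V W U : lmodType K) (f : W -> U) (g : V -> W) :
  linear f -> linear g -> linear (fun x => f (g x)).
Proof. by move=> f_lin g_lin a x y; rewrite g_lin f_lin. Qed.

Let r12_r13_body (c : K) :
  (forall x y, is_bilinear (fun x' y' => c *: br x x' ⊗ alpha y ⊗ alpha y')) /\
  (forall x' y', is_bilinear (fun x y => c *: br x x' ⊗ alpha y ⊗ alpha y')).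
Proof.
split=> x y; apply: bilinear_scale; split=> u.
- exact: linear_comp (tlin' _) (br_lin x).
- exact: linear_comp (tlin _) (linear_comp (tlin _) alpha_lin).
- exact: linear_comp (tlin' _) (br_lin' x).
- exact: linear_comp (tlin _) (linear_comp (tlin' _) alpha_lin).
Qed.

Let r12_r23_body :
  (forall x y, is_bilinear (fun x' y' => alpha x ⊗ br y x' ⊗ alpha y')) /\
  (forall x' y', is_bilinear (fun x y => alpha x ⊗ br y x' ⊗ alpha y')).
Proof.
split=> x y; split=> u.
- exact: linear_comp (tlin _) (linear_comp (tlin' _) (br_lin y)).
- exact: linear_comp (tlin _) (linear_comp (tlin _) alpha_lin).
- exact: linear_comp (tlin' _) alpha_lin.
- exact: linear_comp (tlin _) (linear_comp (tlin' _) (br_lin' x)).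
Qed.

Let r13_r23_body (c : K) :
  (forall x y, is_bilinear (fun x' y' => c *: alpha x ⊗ alpha x' ⊗ br y y')) /\
  (forall x' y', is_bilinear (fun x y => c *: alpha x ⊗ alpha x' ⊗ br y y')).
Proof.
split=> x y; apply: bilinear_scale; split=> u.
- exact: linear_comp (tlin _) (linear_comp (tlin' _) alpha_lin).
- exact: linear_comp (tlin _) (linear_comp (tlin _) (br_lin y)).
- exact: linear_comp (tlin' _) alpha_lin.
- exact: linear_comp (tlin _) (linear_comp (tlin _) (br_lin' y)).
Qed.

Lemma r12_r13_bilinear : is_bilinear (r12_r13 br alpha).
Proof. by apply: two_copies_bilinear => *; apply r12_r13_body. Qed.

Lemma r12_r23_bilinear : is_bilinear (r12_r23 br alpha).
Proof. by apply: two_copies_bilinear => *; apply r12_r23_body. Qed.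

Lemma r13_r23_bilinear : is_bilinear (r13_r23 br alpha).
Proof. by apply: two_copies_bilinear => *; apply r13_r23_body. Qed.

Lemma r12_r13E i j i' j' x y x' y' :
  homog i x -> homog j y -> homog i' x' -> homog j' y' ->
  r12_r13 br alpha (x ⊗ y) (x' ⊗ y') =
    (-1) ^+ (i' && j) *: br x x' ⊗ alpha y ⊗ alpha y'.
Proof. by apply: two_copiesE => *; apply r12_r13_body. Qed.

Lemma r12_r23E i j i' j' x y x' y' :
  homog i x -> homog j y -> homog i' x' -> homog j' y' ->
  r12_r23 br alpha (x ⊗ y) (x' ⊗ y') = alpha x ⊗ br y x' ⊗ alpha y'.
Proof.
apply: (two_copiesE (F := fun i j x y i' j' x' y' => alpha x ⊗ br y x' ⊗ alpha y')) => *;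
  apply r12_r23_body.
Qed.

Lemma r13_r23E i j i' j' x y x' y' :
  homog i x -> homog j y -> homog i' x' -> homog j' y' ->
  r13_r23 br alpha (x ⊗ y) (x' ⊗ y') =
    (-1) ^+ (i' && j) *: alpha x ⊗ alpha x' ⊗ br y y'.
Proof. by apply: two_copiesE => *; apply r13_r23_body. Qed.

End Evaluation.

(* Main.v *)
(* Write the even tensor r as a finite sum of tensors a ⊗ b with a and b
   homogeneous of the same parity, and put S = [r12, r23].  Skew-symmetry of r
   gives [r12, r13] = xi S and [r13, r23] = xi^2 S, so the Schouten bracket is
   (1 + xi + xi^2) S, and xi (of order 3) commutes with ad_x and alpha^{⊗3}.
   Splitting (alpha ⊗ Delta)(Delta x) = P + Q according to which half of
   Delta(y) = sum [y, a] ⊗ alpha b +- alpha a ⊗ [y, b] is taken in the second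
   application of Delta, the Hom-Jacobi identity together with
   alpha^{⊗2} r = r and r21 = - r yields alpha^{⊗3}(ad_x S) = P + xi Q.  As
   (1 + xi + xi^2) xi = 1 + xi + xi^2, the co-Jacobi expression of x equals
   alpha^{⊗3}(ad_x [[r, r]]).  The cocycle condition is the Hom-Jacobi identity
   applied to r = alpha^{⊗2} r, and co-skew-symmetry holds because tau commutes
   with ad_x, so that Delta x = t - tau t for t = Delta x / 2. *)
Require Import Defs.
From mathcomp Require Import all_boot all_algebra.
From mathcomp Require Import finmap.
From mathcomp.multinomials Require Import monalg.

Set Implicit Arguments.
Unset Strict Implicit.
Unset Printing Implicit Defensive.

Import GRing.Theory.
Local Open Scope ring_scope.

(** * Consequences of the predicate [linear] for unbundled maps *)

Section Linear.
Variables (K : fieldType) (V W : lmodType K) (f : V -> W).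
Hypothesis f_lin : linear f.

Lemma linear_add x y : f (x + y) = f x + f y.
Proof. by have := f_lin 1 x y; rewrite !scale1r. Qed.

Lemma linear_zero : f 0 = 0.
Proof. by apply: (addrI (f 0)); rewrite -linear_add !addr0. Qed.

Lemma linear_scale c x : f (c *: x) = c *: f x.
Proof. by have := f_lin c x 0; rewrite linear_zero !addr0. Qed.

Lemma linear_opp x : f (- x) = - f x.
Proof. by rewrite -scaleN1r linear_scale scaleN1r. Qed.

Lemma linear_bigsum (I : Type) (s : seq I) (F : I -> V) :
  f (\sum_(i <- s) F i) = \sum_(i <- s) f (F i).
Proof. exact: (big_morph f linear_add linear_zero). Qed.

End Linear.

Lemma linear_compose (K : fieldType) (V W U : lmodType K) (f : W -> U) (g : V -> W) :
  linear f -> linear g -> linear (fun x => f (g x)).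
Proof. by move=> f_lin g_lin a x y; rewrite g_lin f_lin. Qed.

Lemma linear_plus (K : fieldType) (V W : lmodType K) (f g : V -> W) :
  linear f -> linear g -> linear (fun x => f x + g x).
Proof. by move=> f_lin g_lin a x y; rewrite f_lin g_lin scalerDr addrACA. Qed.

Lemma linear_minus (K : fieldType) (V W : lmodType K) (f g : V -> W) :
  linear f -> linear g -> linear (fun x => f x - g x).
Proof. by move=> f_lin g_lin a x y; rewrite f_lin g_lin scalerBr opprD addrACA. Qed.

Lemma linear_scaled (K : fieldType) (V W : lmodType K) c (f : V -> W) :
  linear f -> linear (fun x => c *: f x).
Proof. by move=> f_lin a x y; rewrite f_lin scalerDr !scalerA mulrC. Qed.

Lemma tensNl (K : fieldType) (V W : superspaceType K) (v : V) (w : W) : (- v) ⊗ w = - (v ⊗ w).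
Proof. by rewrite -scaleN1r tensZl scaleN1r. Qed.

Lemma tensNr (K : fieldType) (V W : superspaceType K) (v : V) (w : W) : v ⊗ (- w) = - (v ⊗ w).
Proof. by rewrite -scaleN1r tensZr scaleN1r. Qed.

(** * Reduction to homogeneous elements and decomposition of tensors *)

Section HomogeneousExtension.
Variable K : fieldType.

Lemma hcomp_add (V : superspaceType K) (x : V) : x = hcomp true x + hcomp false x.
Proof. by rewrite -[LHS]hcomp_sum big_bool. Qed.

(** The Koszul signs are explicit only on homogeneous arguments; every sign identity below is
    brought there by this extension principle or its tensor versions. *)
Lemma linear_hext (V : superspaceType K) (U : lmodType K) (f g : V -> U) :
  linear f -> linear g -> (forall i x, homog i x -> f x = g x) -> forall x, f x = g x.
Proof.
move=> f_lin g_lin fg x; rewrite (hcomp_add x) (linear_add f_lin) (linear_add g_lin).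
by congr (_ + _); apply: fg; exact: homog_hcomp.
Qed.

Lemma tens_hext (V W : superspaceType K) (U : lmodType K) (f g : V ⊗ W -> U) :
  linear f -> linear g ->
  (forall i j x y, homog i x -> homog j y -> f (x ⊗ y) = g (x ⊗ y)) ->
  forall t, f t = g t.
Proof.
move=> f_lin g_lin fg; apply: (tens_ext f_lin g_lin) => x y; move: x.
have lt (y' : W) : linear (fun x : V => x ⊗ y') := (@tens_bilinear K V W).1 y'.
have rt (x : V) : linear (fun y' : W => x ⊗ y') := (@tens_bilinear K V W).2 x.
apply: linear_hext; [exact: linear_compose f_lin (lt y) | exact: linear_compose g_lin (lt y)|].
move=> i x hx; move: y.
apply: linear_hext; [exact: linear_compose f_lin (rt x) | exact: linear_compose g_lin (rt x)|].
by move=> j y hy; exact: fg hx hy.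
Qed.

Lemma tens3_hext (V W X : superspaceType K) (U : lmodType K) (f g : V ⊗ W ⊗ X -> U) :
  linear f -> linear g ->
  (forall i j k x y z, homog i x -> homog j y -> homog k z ->
     f (x ⊗ y ⊗ z) = g (x ⊗ y ⊗ z)) ->
  forall t, f t = g t.
Proof.
move=> f_lin g_lin fg; apply: (tens_ext f_lin g_lin) => x t; move: x.
have lt (t : W ⊗ X) : linear (fun x : V => x ⊗ t) := (@tens_bilinear K V _).1 t.
have rt (x : V) : linear (fun t : W ⊗ X => x ⊗ t) := (@tens_bilinear K V _).2 x.
apply: linear_hext; [exact: linear_compose f_lin (lt t) | exact: linear_compose g_lin (lt t)|].
move=> i x hx; move: t.
apply: tens_hext; [exact: linear_compose f_lin (rt x) | exact: linear_compose g_lin (rt x)|].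
by move=> j k y z hy hz; apply: fg hx hy hz.
Qed.

Lemma tens_decomp (V W : superspaceType K) (t : V ⊗ W) :
  exists n (a : 'I_n -> V) (b : 'I_n -> W), t = \sum_s a s ⊗ b s.
Proof.
(* The body of tlift, taken with f = ⊗, exhibits the decomposition. *)
have tE : tlift (fun x y => x ⊗ y) t = t.
  apply: (tens_ext (f := tlift (fun x y => x ⊗ y)) (g := id)) => // [|x y].
    exact/tlift_linear/tens_bilinear.
  exact/tliftE/tens_bilinear.
move: tE; rewrite /tlift unlock.
set z := (Z in \sum_(i <- enum_fset (msupp Z)) _); set l := enum_fset _.
(* A nonempty support supplies [p0], the default that [nth] needs; an empty one makes [t] the empty
   sum. Each coefficient is then absorbed into the left factor. *)
case: l => [|p0 l'] => [|tE].
  rewrite big_nil => <-; exists 0%N, (fun=> 0), (fun=> 0).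
  by rewrite big_ord0.
exists (size (p0 :: l')), (fun i => mcoeff (nth p0 (p0 :: l') i) z *: (nth p0 (p0 :: l') i).1).
exists (fun i => (nth p0 (p0 :: l') i).2).
rewrite -[LHS]tE (big_nth p0) big_mkord; apply: eq_bigr => i _.
by rewrite tensZl.
Qed.

Lemma hcomp_tens (V W : superspaceType K) k (x : V) (y : W) :
  hcomp k (x ⊗ y) = \sum_i hcomp i x ⊗ hcomp (i (+) k) y.
Proof.
rewrite {1}/hcomp /= /tens_hcomp tliftE //; apply: bilinear_sum => i.
by apply: bilinear_comp (@tens_bilinear K V W) _ _; exact: hcomp_linear.
Qed.

(** The even projection of [a ⊗ b] keeps only the products of components of equal parity. Indexing
    by a summand together with a parity thus gives one parity [p s] shared by both factors. *)
Lemma even_tens_decomp (V W : superspaceType K) (r : V ⊗ W) : homog false r ->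
  exists (I : finType) (p : I -> bool) (a : I -> V) (b : I -> W),
    [/\ forall s, homog (p s) (a s), forall s, homog (p s) (b s)
      & r = \sum_s a s ⊗ b s].
Proof.
have [n [a [b rE]]] := tens_decomp r.
move=> <-; exists ('I_n * bool)%type, snd, (fun s => hcomp s.2 (a s.1)),
  (fun s => hcomp s.2 (b s.1)).
split=> [s|s|]; [exact: homog_hcomp..|].
rewrite rE (linear_bigsum (@hcomp_linear _ _ _)).
rewrite -(pair_bigA _ (fun i j => hcomp j (a i) ⊗ hcomp j (b i))) /=.
apply: eq_bigr => i _; rewrite hcomp_tens.
by apply: eq_bigr => j _; rewrite addbF.
Qed.

End HomogeneousExtension.

Lemma homog_add (K : fieldType) (V : superspaceType K) i (x y : V) :
  homog i x -> homog i y -> homog i (x + y).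
Proof. by rewrite /homog (linear_add (@hcomp_linear _ _ i)) => -> ->. Qed.

Lemma homog_scale (K : fieldType) (V : superspaceType K) i c (x : V) :
  homog i x -> homog i (c *: x).
Proof. by rewrite /homog (linear_scale (@hcomp_linear _ _ i)) => ->. Qed.

Lemma homog_bigsum (K : fieldType) (V : superspaceType K) i (I : finType) (F : I -> V) :
  (forall s, homog i (F s)) -> homog i (\sum_s F s).
Proof.
move=> hF; rewrite /homog (linear_bigsum (@hcomp_linear _ _ i)).
by apply: eq_bigr => s _; exact: hF.
Qed.

(** * Normalisation of signs and cancellation in signed sums *)

Ltac simpl_signs := rewrite /= ?(expr0, expr1, mulr1, mul1r, mulrN1, mulN1r, opprK, scale1r,
  scaleN1r, scalerN, opprD).

Lemma eq_of_subr_add0 (V : zmodType) (x y : V) : x - y + 0 = 0 -> x = y.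
Proof. by rewrite addr0 => /eqP; rewrite subr_eq0 => /eqP. Qed.

(* Proves an equality of signed sums by cancelling each term against its
   opposite; the final + 0 of eq_of_subr_add0 lets addrCA move the last term. *)
Ltac zmod_cancel :=
  repeat match goal with |- context [?a ⊗ ?b] => move: (a ⊗ b) => ? end;
  apply: eq_of_subr_add0; rewrite ?opprD ?opprK -?addrA;
  repeat match goal with
  | |- - ?h + _ = 0 => repeat rewrite (addrCA _ h); rewrite addNKr
  | |- ?h + _ = 0 => repeat rewrite (addrCA _ (- h)); rewrite addKr
  end; rewrite ?oppr0 ?addr0; exact: erefl.

(** * Dependence of [hlift3] on its defining family *)

Section HomogeneousLiftLinearity.
Variables (K : fieldType) (V W X : superspaceType K) (U : lmodType K).
Implicit Types f g : bool -> bool -> bool -> V -> W -> X -> U.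

(** Needed for the linearity of [ad3] in [x], since [x] enters [ad3] only through the family being
    lifted. *)
Lemma hlift3_linear_fun a f g t :
  hlift3 (fun i j k x y z => a *: f i j k x y z + g i j k x y z) t =
    a *: hlift3 f t + hlift3 g t.
Proof.
rewrite /hlift3 -tlift_linear_fun; apply: eq_tlift => v w; rewrite scaler_sumr -big_split.
by apply: eq_bigr => i _ /=; rewrite -hlift2_linear_fun.
Qed.

Lemma eq_hlift3 f g t :
  (forall i j k x y z, f i j k x y z = g i j k x y z) -> hlift3 f t = hlift3 g t.
Proof. by move=> fg; apply: eq_tlift => v w; apply: eq_bigr => i _; exact: eq_hlift2. Qed.

End HomogeneousLiftLinearity.

(** * The order of the signed cyclic shift *)

Section Xi.
Variables (K : fieldType) (L : superspaceType K).

(** The three shifts contribute the exponent i(j+k) + j(k+i) + k(i+j), which is even. *)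
Lemma xi3 (t : L ⊗ L ⊗ L) : xi (xi (xi t)) = t.
Proof.
have xl := @xi_linear K L.
apply: (tens3_hext (f := fun t => xi (xi (xi t))) (g := id)) => // [|i j k x y z hx hy hz].
  exact: linear_compose xl (linear_compose xl xl).
rewrite (xiE hx hy hz) !(linear_scale xl) (xiE hy hz hx) !(linear_scale xl) (xiE hz hx hy).
rewrite !scalerA; by case: i j k {hx hy hz} => [] [] []; simpl_signs.
Qed.

End Xi.

(** * The twisted adjoint action and its symmetries *)

Section HomLieSuperalgebra.
Variables (K : fieldType) (L : superspaceType K) (br : L -> L -> L) (alpha : L -> L).
Hypothesis L_hom_Lie : multiplicative_hom_Lie_superalgebra br alpha.

Let L_Lie := multiplicative_superalgebra L_hom_Lie.
Let br_bil := bracket_bilinear L_Lie.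
Let br_homog := bracket_even L_Lie.
Let alpha_lin := (superalgebra_twist L_Lie).1.
Let alpha_homog := (superalgebra_twist L_Lie).2.
Let alphaM := alpha_bracket L_hom_Lie.
Let ad2_lin x := ad2_linear br_bil alpha_lin x.
Let ad3_lin x := ad3_linear br_bil alpha_lin x.
Let alpha2 := tens_map alpha alpha.
Let alpha2_lin : linear alpha2 := tens_map_linear alpha_lin alpha_lin.
Let alpha3 := tens_map alpha alpha2.
Let alpha3_lin : linear alpha3 := tens_map_linear alpha_lin alpha2_lin.
Let brr x : linear (br x) := br_bil.2 x.
Let brl y : linear (br^~ y) := br_bil.1 y.

(** Leibniz form of the Hom-Jacobi identity: skew-symmetry reverses the brackets in the last two
    terms, and multiplying by the self-inverse sign (-1)^(ik) isolates the first. *)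
Lemma hom_Jacobi_derivation i j k x y z : homog i x -> homog j y -> homog k z ->
  br (alpha x) (br y z) =
    br (br x y) (alpha z) + (-1) ^+ (i && j) *: br (alpha y) (br x z).
Proof.
move=> hx hy hz; move/eqP: (hom_Jacobi L_Lie hx hy hz).
rewrite (bracket_skew L_Lie (alpha_homog hz) (br_homog hx hy)).
rewrite (bracket_skew L_Lie hz hx) (linear_opp (brr _)) (linear_scale (brr _)).
rewrite !scalerN !scalerA -addrA -opprD subr_eq0 => /eqP.
have sgnK (b : bool) : (-1) ^+ b * (-1) ^+ b = 1 :> K by rewrite -signr_addb addbb.
move/(congr1 (fun v => (-1) ^+ (i && k) *: v)).
rewrite !scalerA sgnK scale1r scalerDr !scalerA => ->.
by case: i j k {hx hy hz} => [] [] []; simpl_signs.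
Qed.

Lemma ad2_linear_arg t : linear (fun x => ad2 br alpha x t).
Proof.
move=> c x y; rewrite /ad2 !big_bool scalerDr addrACA -!hlift2_linear_fun.
congr (_ + _); apply: eq_hlift2 => i j y1 y2; rewrite hcomp_linear !(brl _ _ _ _);
by rewrite (@tens_bilinear K L L).1 (@tens_bilinear K L L).2 !scalerDr !scalerA mulrC addrACA.
Qed.

(** The flip exchanges the two summands of the action; the sign for moving [x] past a factor is the
    one by which the two flips differ. *)
Lemma tau_ad2 x t : tau (ad2 br alpha x t) = ad2 br alpha x (tau t).
Proof.
have tl := @tau_linear K L.
move: x; apply: linear_hext => [||p x hx].
- exact: linear_compose tl (ad2_linear_arg _).
- exact: ad2_linear_arg.
move: t; apply: tens_hext => [||i j y z hy hz].
- exact: linear_compose tl (ad2_lin _).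
- exact: linear_compose (ad2_lin _) tl.
rewrite (ad2E br_bil alpha_lin hx hy hz) (linear_add tl) (linear_scale tl).
rewrite (tauE (br_homog hx hy) (alpha_homog hz)) (tauE (alpha_homog hy) (br_homog hx hz)).
rewrite (tauE hy hz) (linear_scale (ad2_lin x)) (ad2E br_bil alpha_lin hx hz hy).
rewrite scalerDr !scalerA addrC.
by case: p i j {hx hy hz} => [] [] []; simpl_signs.
Qed.

Lemma ad2_alpha x t :
  ad2 br alpha (alpha x) (alpha2 t) = alpha2 (ad2 br alpha x t).
Proof.
move: x; apply: linear_hext => [||p x hx].
- exact: linear_compose (ad2_linear_arg _) alpha_lin.
- exact: linear_compose alpha2_lin (ad2_linear_arg _).
move: t; apply: tens_hext => [||i j y z hy hz].
- exact: linear_compose (ad2_lin _) alpha2_lin.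
- exact: linear_compose alpha2_lin (ad2_lin _).
rewrite (ad2E br_bil alpha_lin hx hy hz) (linear_add alpha2_lin) (linear_scale alpha2_lin).
rewrite /alpha2 !tens_mapE // !alphaM.
exact: ad2E (alpha_homog hx) (alpha_homog hy) (alpha_homog hz).
Qed.

(** The twisted representation property. By multiplicativity the terms with one bracket in each
    factor cancel, and the Leibniz form treats those with a double bracket. For [t] fixed by
    [alpha2] this is the cocycle condition. *)
Lemma ad2_bracket i j x y t : homog i x -> homog j y ->
  ad2 br alpha (br x y) (alpha2 t) =
    ad2 br alpha (alpha x) (ad2 br alpha y t)
    - (-1) ^+ (i && j) *: ad2 br alpha (alpha y) (ad2 br alpha x t).
Proof.
move=> hx hy; move: t; apply: tens_hext => [||k l z w hz hw].
- exact: linear_compose (ad2_lin _) alpha2_lin.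
- apply: linear_minus; last apply: linear_scaled; exact: linear_compose (ad2_lin _) (ad2_lin _).
have aE := ad2E br_bil alpha_lin.
rewrite /alpha2 tens_mapE // (aE _ _ _ _ _ _ (br_homog hx hy) (alpha_homog hz) (alpha_homog hw)).
rewrite (aE _ _ _ _ _ _ hy hz hw) (aE _ _ _ _ _ _ hx hz hw).
rewrite !(linear_add (ad2_lin _)) !(linear_scale (ad2_lin _)).
rewrite (aE _ _ _ _ _ _ (alpha_homog hx) (br_homog hy hz) (alpha_homog hw)).
rewrite (aE _ _ _ _ _ _ (alpha_homog hx) (alpha_homog hz) (br_homog hy hw)).
rewrite (aE _ _ _ _ _ _ (alpha_homog hy) (br_homog hx hz) (alpha_homog hw)).
rewrite (aE _ _ _ _ _ _ (alpha_homog hy) (alpha_homog hz) (br_homog hx hw)).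
rewrite (hom_Jacobi_derivation hx hy hz) (hom_Jacobi_derivation hx hy hw).
rewrite !(tensDl, tensDr, tensZl, tensZr, scalerDr, scalerA) !alphaM.
by case: i j k {hx hy hz} => [] [] []; simpl_signs; zmod_cancel.
Qed.

(** The two factors of each summand of [r] have equal parity, so their parities cancel and only that
    of [x] remains. *)
Lemma ad2_homog p x r : homog p x -> homog false r -> homog p (ad2 br alpha x r).
Proof.
move=> hx /even_tens_decomp [I [q [a [b [ha hb ->]]]]].
rewrite (linear_bigsum (ad2_lin x)); apply: homog_bigsum => s.
rewrite (ad2E br_bil alpha_lin hx (ha s) (hb s)).
apply: homog_add; last apply: homog_scale.
  have := homog_tens (br_homog hx (ha s)) (alpha_homog (hb s)).
  by rewrite -addbA addbb addbF.
have := homog_tens (alpha_homog (ha s)) (br_homog hx (hb s)).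
by rewrite addbC -addbA addbb addbF.
Qed.

Lemma ad3_linear_arg t : linear (fun x => ad3 br alpha x t).
Proof.
move=> c x y; rewrite /ad3 !big_bool scalerDr addrACA -!hlift3_linear_fun.
congr (_ + _); apply: eq_hlift3 => i j k y1 y2 y3; rewrite hcomp_linear (brl _ _ _ _);
  by rewrite !(brl _ _ _ _) !(tensDl, tensDr, tensZl, tensZr);
     rewrite !scalerDr !scalerA ![_ * c]mulrC; zmod_cancel.
Qed.

(** The shift permutes the three summands of the action cyclically, with matching Koszul signs. *)
Lemma xi_ad3 x t : xi (ad3 br alpha x t) = ad3 br alpha x (xi t).
Proof.
have xl := @xi_linear K L.
move: x; apply: linear_hext => [||p x hx].
- exact: linear_compose xl (ad3_linear_arg _).
- exact: ad3_linear_arg.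
move: t; apply: tens3_hext => [||i j k u v w hu hv hw].
- exact: linear_compose xl (ad3_lin _).
- exact: linear_compose (ad3_lin _) xl.
rewrite (ad3E br_bil alpha_lin hx hu hv hw) !(linear_add xl) !(linear_scale xl).
rewrite (xiE (br_homog hx hu) (alpha_homog hv) (alpha_homog hw)).
rewrite (xiE (alpha_homog hu) (br_homog hx hv) (alpha_homog hw)).
rewrite (xiE (alpha_homog hu) (alpha_homog hv) (br_homog hx hw)).
rewrite (xiE hu hv hw) (linear_scale (ad3_lin x)) (ad3E br_bil alpha_lin hx hv hw hu).
rewrite !scalerDr !scalerA.
by case: p i j k {hx hu hv hw} => [] [] [] []; simpl_signs; zmod_cancel.
Qed.

Lemma xi_alpha3 t : xi (alpha3 t) = alpha3 (xi t).
Proof.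
have xl := @xi_linear K L.
move: t; apply: tens3_hext => [||i j k x y z hx hy hz].
- exact: linear_compose xl alpha3_lin.
- exact: linear_compose alpha3_lin xl.
rewrite (xiE hx hy hz) (linear_scale alpha3_lin) /alpha3 /alpha2 !tens_mapE //.
exact: xiE (alpha_homog hx) (alpha_homog hy) (alpha_homog hz).
Qed.

End HomLieSuperalgebra.

(** * Sums over two copies of [r] and the symmetries inherited from [r] *)

Section DoubleSum.
Variables (K : fieldType) (L : superspaceType K) (U : lmodType K) (alpha : L -> L).
Variables (I : finType) (p : I -> bool) (a b : I -> L).
Hypotheses (a_homog : forall s, homog (p s) (a s)) (b_homog : forall s, homog (p s) (b s)).
Let r := \sum_s a s ⊗ b s.
Implicit Types G : bool -> bool -> L -> L -> L -> L -> U.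

(** Each copy of [r] passes to [G] one parity, common to its two factors; properties of [r] then
    become substitutions in [G]. *)
Definition double_sum G : U := \sum_s \sum_t G (p s) (p t) (a s) (b s) (a t) (b t).

Lemma double_sum_swap G :
  double_sum G = double_sum (fun i j x y z w => G j i z w x y).
Proof. exact: exchange_big. Qed.

Lemma eq_double_sum G H :
  (forall i j x y z w, homog i x -> homog i y -> homog j z -> homog j w ->
     G i j x y z w = H i j x y z w) -> double_sum G = double_sum H.
Proof. by move=> GH; apply: eq_bigr => s _; apply: eq_bigr => t _; exact: GH. Qed.

Lemma double_sumD G H :
  double_sum (fun i j x y z w => G i j x y z w + H i j x y z w) =
    double_sum G + double_sum H.
Proof. by rewrite -big_split; apply: eq_bigr => s _; rewrite -big_split. Qed.

(** Such a sum is the value at [r] of a linear map, so equations satisfied by the tensor [r] can be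
    used although they fail summand by summand. *)
Lemma hlift2_sum (F : bool -> L -> L -> U) : (forall i, is_bilinear (F i)) ->
  hlift2 (fun i _ => F i) r = \sum_s F (p s) (a s) (b s).
Proof.
move=> F_bil; have F_lin := hlift2_linear (fun i (_ : bool) => F_bil i).
rewrite (linear_bigsum F_lin); apply: eq_bigr => s _.
exact: (hlift2E (f := fun i _ => F i)) (fun i (_ : bool) => F_bil i) (a_homog s) (b_homog s).
Qed.

(** The same linear map is evaluated at [r] and at [- tau r]; as both factors have parity [p s], the
    flip costs (-1)^(p s). *)
Lemma sum_flip (F : bool -> L -> L -> U) : tau r = - r -> (forall i, is_bilinear (F i)) ->
  \sum_s F (p s) (a s) (b s) = \sum_s - ((-1) ^+ p s *: F (p s) (b s) (a s)).
Proof.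
move=> r_skew F_bil; have F_lin := hlift2_linear (fun i (_ : bool) => F_bil i).
have tl := @tau_linear K L.
rewrite -hlift2_sum // -[r in LHS]opprK -r_skew (linear_opp F_lin).
rewrite (linear_bigsum tl) (linear_bigsum F_lin) sumrN; congr (- _).
apply: eq_bigr => s _; rewrite (tauE (a_homog s) (b_homog s)) andbb (linear_scale F_lin).
by congr (_ *: _);
  exact: (hlift2E (f := fun i _ => F i)) (fun i (_ : bool) => F_bil i) (b_homog s) (a_homog s).
Qed.

Lemma double_sum_flip G : tau r = - r ->
  (forall i j z w, is_bilinear (fun x y => G i j x y z w)) ->
  double_sum G = double_sum (fun i j x y z w => - ((-1) ^+ i *: G i j y x z w)).
Proof.
move=> r_skew G_bil; rewrite /double_sum exchange_big [RHS]exchange_big.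
apply: eq_bigr => t _; exact: (sum_flip (F := fun i x y => G i (p t) x y (a t) (b t))).
Qed.

Hypothesis alpha_even : is_even_linear alpha.
Hypothesis r_alpha : tens_map alpha alpha r = r.

Lemma sum_twist (F : bool -> L -> L -> U) : (forall i, is_bilinear (F i)) ->
  \sum_s F (p s) (a s) (b s) = \sum_s F (p s) (alpha (a s)) (alpha (b s)).
Proof.
move=> F_bil; have F_lin := hlift2_linear (fun i (_ : bool) => F_bil i).
have [al ah] := alpha_even.
rewrite -hlift2_sum // -[r in LHS]r_alpha (linear_bigsum (tens_map_linear al al)).
rewrite (linear_bigsum F_lin); apply: eq_bigr => s _; rewrite tens_mapE //.
exact: (hlift2E (f := fun i _ => F i)) (fun i (_ : bool) => F_bil i)
  (ah _ _ (a_homog s)) (ah _ _ (b_homog s)).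
Qed.

Lemma double_sum_twistl G : (forall i j z w, is_bilinear (fun x y => G i j x y z w)) ->
  double_sum G = double_sum (fun i j x y z w => G i j (alpha x) (alpha y) z w).
Proof.
move=> G_bil; rewrite /double_sum exchange_big [RHS]exchange_big.
apply: eq_bigr => t _; exact: (sum_twist (F := fun i x y => G i (p t) x y (a t) (b t))).
Qed.

Lemma double_sum_twistr G : (forall i j x y, is_bilinear (G i j x y)) ->
  double_sum G = double_sum (fun i j x y z w => G i j x y (alpha z) (alpha w)).
Proof.
move=> G_bil; apply: eq_bigr => s _.
exact: (sum_twist (F := fun j z w => G (p s) j (a s) (b s) z w)).
Qed.

End DoubleSum.

(** * The Schouten bracket of a skew-symmetric [r] as a cyclic sum *)

Section Coboundary.
Variables (K : fieldType) (L : superspaceType K) (br : L -> L -> L) (alpha : L -> L).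
Hypothesis L_hom_Lie : multiplicative_hom_Lie_superalgebra br alpha.

Let L_Lie := multiplicative_superalgebra L_hom_Lie.
Let br_bil := bracket_bilinear L_Lie.
Let br_homog := bracket_even L_Lie.
Let alpha_even := superalgebra_twist L_Lie.
Let alpha_lin := alpha_even.1.
Let alpha_homog := alpha_even.2.
Let alphaM := alpha_bracket L_hom_Lie.
Let alpha2 := tens_map alpha alpha.
Let alpha2_lin : linear alpha2 := tens_map_linear alpha_lin alpha_lin.
Let alpha3 := tens_map alpha alpha2.
Let alpha3_lin : linear alpha3 := tens_map_linear alpha_lin alpha2_lin.
Let ad2_lin x := ad2_linear br_bil alpha_lin x.
Let ad3_lin x := ad3_linear br_bil alpha_lin x.

Variables (I : finType) (p : I -> bool) (a b : I -> L).
Hypotheses (a_homog : forall s, homog (p s) (a s)) (b_homog : forall s, homog (p s) (b s)).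
Let r := \sum_s a s ⊗ b s.
Hypotheses (r_alpha : tens_map alpha alpha r = r) (r_skew : tau r = - r).

Local Notation Phi := (double_sum p a b).

Let brlE c x y w : br (c *: x + y) w = c *: br x w + br y w.
Proof. exact: br_bil.1. Qed.
Let brrE c x y w : br w (c *: x + y) = c *: br w x + br w y.
Proof. exact: br_bil.2. Qed.
Let alphaE c x y : alpha (c *: x + y) = c *: alpha x + alpha y.
Proof. exact: alpha_lin. Qed.
Let tlE (V W : superspaceType K) c (x y : V) (w : W) :
  (c *: x + y) ⊗ w = c *: x ⊗ w + y ⊗ w.
Proof. exact: (@tens_bilinear K V W).1. Qed.
Let trE (V W : superspaceType K) c (x y : W) (w : V) :
  w ⊗ (c *: x + y) = c *: w ⊗ x + w ⊗ y.
Proof. exact: (@tens_bilinear K V W).2. Qed.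
Let linE := (brlE, brrE, alphaE, tlE, trE).

Ltac bilin :=
  move=> *; try apply: bilinear_scale; split=> ? ? ? ? /=; rewrite !linE; reflexivity.

Let bil_sum2 (F : L ⊗ L -> L ⊗ L -> L ⊗ L ⊗ L) : is_bilinear F ->
  F r r = \sum_s \sum_t F (a s ⊗ b s) (a t ⊗ b t).
Proof.
move=> [Fl Fr]; rewrite {1}/r (linear_bigsum (Fl r)); apply: eq_bigr => s _.
by rewrite /r (linear_bigsum (Fr _)).
Qed.

Lemma r12_r23_sum : r12_r23 br alpha r r =
  Phi (fun i j x y z w => alpha x ⊗ br y z ⊗ alpha w).
Proof.
rewrite (bil_sum2 (r12_r23_bilinear br_bil alpha_lin)).
by apply: eq_bigr => s _; apply: eq_bigr => t _;
  rewrite (r12_r23E br_bil alpha_lin (a_homog s) (b_homog s) (a_homog t) (b_homog t)).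
Qed.

Lemma r12_r13_sum : r12_r13 br alpha r r =
  Phi (fun i j x y z w => (-1) ^+ (j && i) *: br x z ⊗ alpha y ⊗ alpha w).
Proof.
rewrite (bil_sum2 (r12_r13_bilinear br_bil alpha_lin)).
by apply: eq_bigr => s _; apply: eq_bigr => t _;
  rewrite (r12_r13E br_bil alpha_lin (a_homog s) (b_homog s) (a_homog t) (b_homog t)).
Qed.

Lemma r13_r23_sum : r13_r23 br alpha r r =
  Phi (fun i j x y z w => (-1) ^+ (j && i) *: alpha x ⊗ alpha z ⊗ br y w).
Proof.
rewrite (bil_sum2 (r13_r23_bilinear br_bil alpha_lin)).
by apply: eq_bigr => s _; apply: eq_bigr => t _;
  rewrite (r13_r23E br_bil alpha_lin (a_homog s) (b_homog s) (a_homog t) (b_homog t)).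
Qed.

Let Phi_lin (f : L ⊗ L ⊗ L -> L ⊗ L ⊗ L) G : linear f ->
  f (Phi G) = Phi (fun i j x y z w => f (G i j x y z w)).
Proof.
move=> f_lin; rewrite (linear_bigsum f_lin); apply: eq_bigr => s _.
exact: linear_bigsum.
Qed.

(** Flipping the first copy and exchanging the copies gives the right factors with the bracket
    reversed; the minus sign of the flip cancels that of bracket skew-symmetry. *)
Lemma xi_r12_r23 : xi (r12_r23 br alpha r r) = r12_r13 br alpha r r.
Proof.
have xl := @xi_linear K L.
rewrite r12_r23_sum r12_r13_sum (Phi_lin _ xl).
(* The shift has exponent i((i+j)+j), which is i modulo 2. *)
transitivity (Phi (fun i j x y z w => (-1) ^+ i *: br y z ⊗ alpha w ⊗ alpha x)).
  apply: eq_double_sum => // i j x y z w hx hy hz hw.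
  rewrite (xiE (alpha_homog hx) (br_homog hy hz) (alpha_homog hw)).
  by case: i j {hx hy hz hw} => [] [].
rewrite (double_sum_flip a_homog b_homog r_skew); last by bilin.
rewrite double_sum_swap; apply: eq_double_sum => // i j x y z w hx hy hz hw.
rewrite (bracket_skew L_Lie hx hz) tensNl tensZl !scalerN scalerA.
by case: i j {hx hy hz hw} => [] []; simpl_signs.
Qed.

Lemma xi2_r12_r23 : xi (xi (r12_r23 br alpha r r)) = r13_r23 br alpha r r.
Proof.
have xl := @xi_linear K L.
rewrite r12_r23_sum r13_r23_sum (Phi_lin _ (linear_compose xl xl)).
transitivity (Phi (fun i j x y z w => (-1) ^+ j *: alpha w ⊗ alpha x ⊗ br y z)).
  apply: eq_double_sum => // i j x y z w hx hy hz hw.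
  rewrite (xiE (alpha_homog hx) (br_homog hy hz) (alpha_homog hw)) (linear_scale xl).
  rewrite (xiE (br_homog hy hz) (alpha_homog hw) (alpha_homog hx)) scalerA.
  by case: i j {hx hy hz hw} => [] []; simpl_signs.
(* Here the copies are exchanged first, so the flip acts on the original second copy. *)
rewrite double_sum_swap (double_sum_flip a_homog b_homog r_skew); last by bilin.
apply: eq_double_sum => // i j x y z w hx hy hz hw.
rewrite (bracket_skew L_Lie hw hy) !tensNr !tensZr !scalerN !scalerA.
by case: i j {hx hy hz hw} => [] []; simpl_signs.
Qed.

Lemma hom_schouten_xi :
  hom_schouten br alpha r =
    r12_r23 br alpha r r + xi (r12_r23 br alpha r r) + xi (xi (r12_r23 br alpha r r)).
Proof. by rewrite xi2_r12_r23 xi_r12_r23 /hom_schouten [X in X + _ = _]addrC. Qed.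

(** * The iterated cobracket of a homogeneous [x] *)

Variables (q : bool) (x : L).
Hypothesis x_homog : homog q x.
Let Delta y := ad2 br alpha y r.
Let Delta_lin : linear Delta := ad2_linear_arg L_hom_Lie r.

(** The second cobracket brackets into the middle tensor slot in [P] and into the last slot in [Q];
    the extra signs of [Q] come from passing [z], of parity [j]. *)
Let P i (j : bool) (u v z w : L) : L ⊗ L ⊗ L :=
  alpha (br x u) ⊗ br (alpha v) z ⊗ alpha w
  + (-1) ^+ (q && i) *: alpha (alpha u) ⊗ br (br x v) z ⊗ alpha w.
Let Q i j (u v z w : L) : L ⊗ L ⊗ L :=
  (-1) ^+ (i && j) *: alpha (br x u) ⊗ alpha z ⊗ br (alpha v) w
  + (-1) ^+ ((q && i) (+) ((q (+) i) && j)) *: alpha (alpha u) ⊗ alpha z ⊗ br (br x v) w.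

Lemma cobracket_cobracket_sum : tens_map alpha Delta (Delta x) = Phi P + Phi Q.
Proof.
have tens_sumr v (F : I -> L ⊗ L) : v ⊗ \sum_t F t = \sum_t v ⊗ F t :> L ⊗ L ⊗ L.
  exact: (linear_bigsum ((@tens_bilinear K L (L ⊗ L)%type).2 v)).
have DE i v : homog i v -> Delta v =
    \sum_t (br v (a t) ⊗ alpha (b t) + (-1) ^+ (i && p t) *: alpha (a t) ⊗ br v (b t)).
  move=> hv; rewrite /Delta {1}/r (linear_bigsum (ad2_lin v)); apply: eq_bigr => t _.
  exact: ad2E.
rewrite (DE q) // (linear_bigsum (tens_map_linear alpha_lin Delta_lin)).
rewrite -double_sumD; apply: eq_bigr => s _.
rewrite (linear_add (tens_map_linear alpha_lin Delta_lin)).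
rewrite (linear_scale (tens_map_linear alpha_lin Delta_lin)) !tens_mapE //.
rewrite (DE _ _ (alpha_homog (b_homog s))) (DE _ _ (br_homog x_homog (b_homog s))).
rewrite !tens_sumr scaler_sumr -big_split; apply: eq_bigr => t _ /=.
rewrite !tensDr !tensZr /P /Q scalerDr scalerA -signr_addb.
by rewrite -!addrA; congr (_ + _); rewrite addrCA.
Qed.

(** The outer [alpha3] turns [x,[v,z]] into [alpha x,[alpha v,alpha z]], where the Leibniz form
    applies. Its first half joins the term with [x] in the first slot to give [P]; its second half
    joins the term with [x] in the last slot to give the shift of [Q]. *)
Lemma ad3_r12_r23_sum :
  alpha3 (ad3 br alpha x (r12_r23 br alpha r r)) = Phi P + xi (Phi Q).
Proof.
have xl := @xi_linear K L.
rewrite r12_r23_sum (Phi_lin _ (linear_compose alpha3_lin (ad3_lin x))) (Phi_lin _ xl).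
(* Twisting the first copy once and the second twice matches the powers of [alpha] on the left-hand
   side. *)
have PE : Phi P = Phi (fun i j u v z w =>
    alpha (br x (alpha u)) ⊗ br (alpha (alpha v)) (alpha (alpha z)) ⊗ alpha (alpha (alpha w))
    + (-1) ^+ (q && i) *: alpha (alpha (alpha u)) ⊗ br (br x (alpha v)) (alpha (alpha z))
        ⊗ alpha (alpha (alpha w))).
  rewrite (double_sum_twistl a_homog b_homog alpha_even r_alpha); last first.
    by move=> *; apply: bilinear_add; bilin.
  rewrite (double_sum_twistr a_homog b_homog alpha_even r_alpha); last first.
    by move=> *; apply: bilinear_add; bilin.
  rewrite (double_sum_twistr a_homog b_homog alpha_even r_alpha) //.
  by move=> *; apply: bilinear_add; bilin.
have QE : Phi (fun i j u v z w => xi (Q i j u v z w)) = Phi (fun i j u v z w =>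
    (-1) ^+ (q && j) *: alpha (alpha (alpha u)) ⊗ br (alpha (alpha v)) (alpha (alpha z))
      ⊗ alpha (br x (alpha w))
    + alpha (alpha (alpha u)) ⊗ br (alpha (alpha v)) (br x (alpha z)) ⊗ alpha (alpha (alpha w))).
  (* Both brackets are reversed; [~~ i] in the exponent records the resulting minus sign, and the
     later flip of the first copy, with sign -(-1)^i, removes it. *)
  transitivity (Phi (fun i j u v z w =>
      (-1) ^+ (~~ i (+) (q && i)) *: alpha z ⊗ br w (alpha v) ⊗ alpha (br x u)
      + (-1) ^+ (~~ i) *: alpha z ⊗ br w (br x v) ⊗ alpha (alpha u))).
    apply: eq_double_sum => // i j u v z w hu hv hz hw.
    rewrite /Q (linear_add xl) !(linear_scale xl).
    rewrite (xiE (alpha_homog (br_homog x_homog hu)) (alpha_homog hz)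
              (br_homog (alpha_homog hv) hw)).
    rewrite (xiE (alpha_homog (alpha_homog hu)) (alpha_homog hz)
              (br_homog (br_homog x_homog hv) hw)).
    rewrite (bracket_skew L_Lie hw (alpha_homog hv)).
    rewrite (bracket_skew L_Lie hw (br_homog x_homog hv)).
    rewrite !(tensNl, tensNr, tensZl, tensZr, scalerN, scalerA).
    by move: (q) (i) (j) => [] [] []; simpl_signs.
  rewrite (double_sum_twistl a_homog b_homog alpha_even r_alpha); last first.
    by move=> *; apply: bilinear_add; bilin.
  rewrite (double_sum_twistr a_homog b_homog alpha_even r_alpha); last first.
    by move=> *; apply: bilinear_add; bilin.
  rewrite (double_sum_twistr a_homog b_homog alpha_even r_alpha); last first.
    by move=> *; apply: bilinear_add; bilin.
  rewrite (double_sum_flip a_homog b_homog r_skew) 1?double_sum_swap; last first.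
    by move=> *; apply: bilinear_add; bilin.
  apply: eq_double_sum => // i j u v z w hu hv hz hw.
  by move: (q) (j) => [] []; simpl_signs.
rewrite PE QE -double_sumD; apply: eq_double_sum => // i j u v z w hu hv hz hw.
rewrite (ad3E br_bil alpha_lin x_homog (alpha_homog hu) (br_homog hv hz) (alpha_homog hw)).
rewrite !(linear_add alpha3_lin) !(linear_scale alpha3_lin) /alpha3 /alpha2 !tens_mapE //.
rewrite [alpha (br x (br v z))]alphaM [alpha (br v z)]alphaM.
rewrite (hom_Jacobi_derivation L_hom_Lie x_homog (alpha_homog hv) (alpha_homog hz)).
rewrite !alphaM !(tensDl, tensDr, tensZl, tensZr, scalerDr, scalerA).
by move: (q) (i) (j) => [] [] []; simpl_signs; zmod_cancel.
Qed.

End Coboundary.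

(** * Assembly of the coboundary structure *)

Theorem theorem3p12 (K : fieldType) (charK0 : [pchar K] =i pred0)
    (L : superspaceType K) (br : L -> L -> L) (alpha : L -> L) (r : L ⊗ L)
    (L_hom_Lie : multiplicative_hom_Lie_superalgebra br alpha)
    (r_even : homog false r)
    (r_alpha : tens_map alpha alpha r = r)
    (r_skew : tau r = - r)
    (r_ad : forall x : L,
       tens_map alpha (tens_map alpha alpha)
         (ad3 br alpha x (hom_schouten br alpha r)) = 0) :
  multiplicative_coboundary_hom_Lie_superbialgebra
    br (fun x => ad2 br alpha x r) alpha r.
Proof.
have L_Lie := multiplicative_superalgebra L_hom_Lie.
have br_bil := bracket_bilinear L_Lie.
have alpha_lin := (superalgebra_twist L_Lie).1.
have xl := @xi_linear K L; have tl := @tau_linear K L.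
have alpha3_lin := tens_map_linear alpha_lin (tens_map_linear alpha_lin alpha_lin).
have Delta_lin := ad2_linear_arg L_hom_Lie r.
have cobr_lin := tens_map_linear alpha_lin Delta_lin.
have coJacobi x : let t := tens_map alpha (fun y => ad2 br alpha y r) (ad2 br alpha x r) in
    t + xi t + xi (xi t) = 0.
  move: x; apply: linear_hext => [|c y z|q x x_homog] /=.
  - apply: linear_plus; [apply: linear_plus|]; do ?exact: linear_compose cobr_lin Delta_lin.
      exact: linear_compose xl (linear_compose cobr_lin Delta_lin).
    exact: linear_compose xl (linear_compose xl (linear_compose cobr_lin Delta_lin)).
  - by rewrite scaler0 addr0.
  have [I [p [a [b [ha hb rE]]]]] := even_tens_decomp r_even.
  rewrite {}rE in r_alpha r_skew r_ad *.
  rewrite (cobracket_cobracket_sum L_hom_Lie ha hb x_homog).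
  move: (r_ad x); rewrite (hom_schouten_xi L_hom_Lie ha hb r_skew).
  rewrite !(linear_add (ad3_linear br_bil alpha_lin x)) !(linear_add alpha3_lin).
  rewrite -!(xi_ad3 L_hom_Lie) -!(xi_alpha3 L_hom_Lie).
  rewrite (ad3_r12_r23_sum L_hom_Lie ha hb r_alpha r_skew x_homog).
  (* The right-hand zero becomes the expansion of (1 + xi + xi^2)(P + xi Q), in which xi^3 Q has
     been reduced to Q; both sides now have the same six terms. *)
  rewrite !(linear_add xl) xi3 => <-.
  set P := double_sum _ _ _ _; set Q := double_sum _ _ _ _.
  move: P Q (xi P) (xi Q) (xi (xi P)) (xi (xi Q)) => P Q P' Q' P'' Q''.
  rewrite -!addrA; congr (_ + _).
  by zmod_cancel.
have co : hom_Lie_supercoalgebra (fun x => ad2 br alpha x r) alpha.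
  split=> //.
  - split=> // i x hx; exact: ad2_homog.
  - exact: superalgebra_twist L_Lie.
  move=> x; exists (2%:R^-1 *: ad2 br alpha x r).
  have two_neq0 : 2%:R != 0 :> K.
    by apply/negP => two0; have := charK0 2; rewrite !inE two0.
  rewrite (linear_scale tl) (tau_ad2 L_hom_Lie) r_skew (linear_opp (ad2_linear br_bil alpha_lin x)).
  by rewrite scalerN opprK -scalerDl -mulr2n -[_ *+ 2]mulr_natl divff // scale1r.
have bi : hom_Lie_superbialgebra br (fun x => ad2 br alpha x r) alpha.
  split=> // i j x y hx hy.
  by rewrite -(ad2_bracket L_hom_Lie r hx hy) r_alpha.
split=> //; split=> //; split=> // x.
by rewrite -(ad2_alpha L_hom_Lie) r_alpha.
Qed.
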